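(* Let $n\ge1$, let $k\ge2$ be even, $\mathbb{K}\in\{\mathbb{R},\mathbb{C}\}$, $\star\in\{H,T\}$, $\epsilon_1,\epsilon_2\in\{1,-1\}$, $\epsilon=\epsilon_1\epsilon_2$. Let $0\le l<kn$, $X=[X_F,X_\infty]\in\mathbb{K}^{n\times kn}$ with $X_F\in\mathbb{K}^{n\times l}$, and $J=\mathrm{diag}(J_F^{-1},J_\infty)\in\mathbb{K}^{kn\times kn}$, where $J_F\in\mathbb{K}^{l\times l}$ is nonsingular and $J_\infty\in\mathbb{K}^{(kn-l)\times(kn-l)}$ is a Jordan matrix whose only eigenvalue is $0$. Then $(X,J)$ is a standard pair of the reversal $Q(\mu)=\mu^kA_0+\mu^{k-1}A_1+\cdots+\mu A_{k-1}+A_k$ of a $(\star,\epsilon_1,\epsilon_2)$-structured matrix polynomial $P(\lambda)=\sum_{j=0}^k\lambda^jA_j$ over $\mathbb{K}$ with $A_0$ nonsingular and $A_k$ singular if and only if $X_L$ is nonsingular and there exists a nonsingular $\mathcal{T}\in\mathbb{K}^{kn\times kn}$ such that $\mathcal{T}\in\mathcal{S}_{(J,\star,\epsilon_1,\epsilon_2)}$, $XJ^{k-1}\mathcal{T}X^\star$ is nonsingular, and $$XJ^r\mathcal{T}X^\star=0,\qquad r=0,1,\ldots,k-2.$$ In this case, for such a $\mathcal{T}$, the coefficient matrices can be expressed as $$A_0=(XJ^{k-1}\mathcal{T}X^\star)^{-1},\qquad A_{k-j}=-\sum_{i=j+1}^kA_{k-i}XJ^{k-j+i-1}\mathcal{T}X^\star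 A_0,\quad j=k-1,k-2,\ldots,0.$$ (That is: if $(X,J)$ is a standard pair of such a $Q$, then some such $\mathcal{T}$ yields the $A_j$ by these formulas; conversely, for any such $\mathcal{T}$, with $X_L$ nonsingular, the formulas define such a $Q$ having $(X,J)$ as a standard pair.)
   Context: $A^H$ and $A^T$ denote the conjugate transpose and the transpose; $A^\star$ is whichever is selected by $\star$. A matrix polynomial $P(\lambda)=\sum_{j=0}^k\lambda^jA_j$ with $A_j\in\mathbb{K}^{n\times n}$ is $(\star,\epsilon_1,\epsilon_2)$-structured if $A_j^\star=\epsilon_1A_j$ for even $j$ and $A_j^\star=\epsilon_2A_j$ for odd $j$. $X_L\in\mathbb{K}^{kn\times kn}$ is obtained by stacking $X,XJ,\ldots,XJ^{k-1}$ (top to bottom). $(X,J)$ is a standard pair of $Q(\mu)$ if $X_L$ is nonsingular and $A_0XJ^k+A_1XJ^{k-1}+\cdots+A_{k-1}XJ+A_kX=0$. (Here $(X_F,J_F)$ plays the role of the finite and $(X_\infty,J_\infty)$ of the infinite standard pair of $P$.) For $\Phi\in\mathbb{K}^{m\times m}$, $\mathcal{S}_{(\Phi,\star,\epsilon_1,\epsilon_2)}=\{S\in\mathbb{K}^{m\times m}: S^\star=\epsilon_2S,\ S\Phi^\star=\epsilon\,\Phi S\}$. *)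

(* Defs.v *)
From mathcomp Require Import all_boot all_order all_algebra.
From mathcomp Require Import reals complex.

Set Implicit Arguments.
Unset Strict Implicit.
Unset Printing Implicit Defensive.

Import GRing.Theory.
Local Open Scope ring_scope.

Inductive base_field := RealField | ComplexField.

Definition field_of (R : realType) (F : base_field) : fieldType :=
  match F with
  | RealField => R : fieldType
  | ComplexField => R[i] : fieldType
  end.

Definition conj_scalar (R : realType) (F : base_field) :
    field_of R F -> field_of R F :=
  match F return field_of R F -> field_of R F with
  | RealField => fun x => x
  | ComplexField => fun z : R[i] => conjc z
  end.
Arguments conj_scalar {R F}.

Inductive star_op := ConjTranspose | Transpose.

Definition star (R : realType) (F : base_field) (s : star_op) (m n : nat)
    (A : 'M[field_of R F]_(m, n)) : 'M[field_of R F]_(n, m) :=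
  match s with
  | ConjTranspose => map_mx conj_scalar A^T
  | Transpose => A^T
  end.

(* P(lambda) = \sum_(j < k.+1) lambda^j A_j is given by its k + 1 coefficients.
   Here k is the grade: A_k may be singular, even zero. *)
Definition mxpolynomial (K : fieldType) (n k : nat) : Type :=
  {ffun 'I_k.+1 -> 'M[K]_n}.

(* rev_ord j is k - j. *)
Definition reversal (K : fieldType) (n k : nat) (A : mxpolynomial K n k) :
    mxpolynomial K n k :=
  [ffun j => A (rev_ord j)].

Definition structured (R : realType) (F : base_field) (s : star_op)
    (e1 e2 : field_of R F) (n k : nat)
    (A : mxpolynomial (field_of R F) n k) : Prop :=
  forall j : 'I_k.+1, star s (A j) = (if odd j then e2 else e1) *: A j.

Lemma sum_const_ord (k n : nat) : (\sum_(i < k) n = k * n)%N.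
Proof. by rewrite sum_nat_const card_ord. Qed.

(* X_L: the blocks X, X J, ..., X J^(k-1) from top to bottom. *)
Definition stack (K : fieldType) (n k : nat) (X : 'M[K]_(n, k * n))
    (J : 'M[K]_(k * n)) : 'M[K]_(k * n) :=
  castmx (sum_const_ord k n, erefl) (\mxcol_(i < k) (X *m J ^+ i)).

Definition standard_pair (K : fieldType) (n k : nat) (X : 'M[K]_(n, k * n))
    (J : 'M[K]_(k * n)) (Q : mxpolynomial K n k) : Prop :=
  stack X J \in unitmx /\ \sum_(j < k.+1) Q j *m X *m J ^+ j = 0.

Definition S_set (R : realType) (F : base_field) (s : star_op)
    (e1 e2 : field_of R F) (m : nat) (Phi S : 'M[field_of R F]_m) : Prop :=
  star s S = e2 *: S /\ S *m star s Phi = (e1 * e2) *: (Phi *m S).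

Definition jordan_block (K : fieldType) (a : K) (m : nat) : 'M[K]_m :=
  \matrix_(i, j) (if i == j then a else if i.+1 == j then 1 else 0).

Definition jordan_matrix (K : fieldType) (m : nat) (A : 'M[K]_m) : Prop :=
  exists (r : nat) (p : 'I_r -> nat) (a : 'I_r -> K)
         (e : (\sum_(i < r) p i)%N = m),
    (forall i, (0 < p i)%N) /\
    A = castmx (e, e) (\mxdiag_(i < r) jordan_block (a i) (p i)).

(* [X_F, X_oo] and diag(J_1, J_oo), with the size l + (N - l) cast to N. *)
Definition join_row (K : fieldType) (n l N : nat) (hl : (l <= N)%N)
    (XF : 'M[K]_(n, l)) (Xoo : 'M[K]_(n, N - l)) : 'M[K]_(n, N) :=
  castmx (erefl, subnKC hl) (row_mx XF Xoo).

Definition join_diag (K : fieldType) (l N : nat) (hl : (l <= N)%N)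
    (J1 : 'M[K]_l) (Joo : 'M[K]_(N - l)) : 'M[K]_N :=
  castmx (subnKC hl, subnKC hl) (block_mx J1 0 0 Joo).

(* (X, J) is a standard pair of the reversal of a (star, e1, e2)-structured
   P with nonsingular A_0 and singular A_k. *)
Definition structured_realization (R : realType) (F : base_field)
    (s : star_op) (e1 e2 : field_of R F) (n k : nat)
    (X : 'M[field_of R F]_(n, k * n)) (J : 'M[field_of R F]_(k * n))
    (A : mxpolynomial (field_of R F) n k) : Prop :=
  [/\ structured s e1 e2 A,
      A ord0 \in unitmx,
      A ord_max \notin unitmx &
      standard_pair X J (reversal A)].

Definition admissible (R : realType) (F : base_field)
    (s : star_op) (e1 e2 : field_of R F) (n k : nat)
    (X : 'M[field_of R F]_(n, k * n)) (J T : 'M[field_of R F]_(k * n)) : Prop :=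
  [/\ T \in unitmx,
      S_set s e1 e2 J T,
      X *m J ^+ (k - 1) *m T *m star s X \in unitmx &
      forall r : nat, (r <= k - 2)%N -> X *m J ^+ r *m T *m star s X = 0].

Definition coefficient_formulas (R : realType) (F : base_field)
    (s : star_op) (n k : nat)
    (X : 'M[field_of R F]_(n, k * n)) (J T : 'M[field_of R F]_(k * n))
    (A : mxpolynomial (field_of R F) n k) : Prop :=
  A ord0 = invmx (X *m J ^+ (k - 1) *m T *m star s X) /\
  forall j : 'I_k.+1, (j < k)%N ->
    A (rev_ord j) =
      - \sum_(i < k.+1 | (j < i)%N)
          A (rev_ord i) *m X *m J ^+ (k - j + i - 1) *m T *m star s X
            *m A ord0.

(* Main.v *)
(* Put Q(mu) = \sum_j mu^j Q_j with Q_j = A_(k - j). If X_L is nonsingular and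
   X J^r Y = 0 for r <= k - 2, X J^(k - 1) Y = A_0^-1, then
   Q(mu) \sum_r X J^r Y mu^(-r - 1) = Q(mu) X (mu - J)^-1 Y = 1, so the moments
   M_r = X J^r Y and the coefficients Q_j determine each other as inverse Laurent
   series, and the left inverse is also a right inverse. Hence, for k even, P is
   structured iff star M_r = e2 (e1 e2)^r M_r for all r. For Y = T (star X) with T
   admissible this symmetry of the moments is immediate. Conversely, from a
   structured P one gets Y by solving with X_L, and T is the solution of
   X J^b T = e2 (e1 e2)^b star (J^b Y) for b < k; the right inverse identity
   extends this to b = k, which gives the symmetries of T, and T is
   nonsingular since z J^r Y = 0 for all r forces z = 0. *)
Require Import Defs.
From HB Require Import structures.
From mathcomp Require Import all_boot all_order all_algebra.
From mathcomp Require Import reals complex.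
From mathcomp Require Import zify.

Set Implicit Arguments.
Unset Strict Implicit.
Unset Printing Implicit Defensive.

Import GRing.Theory.
Local Open Scope ring_scope.

(** * Inverse Laurent series as convolution identities *)

(* Q(mu) H(mu) = 1 for Q(mu) = \sum_(i <= k) mu^i q_i and the Laurent series
   H(mu) = \sum_t mu^(k - t) h_t, restricted to the exponents <= k of mu. *)
Definition conv_linv (K : fieldType) (n k : nat) (q h : nat -> 'M[K]_n) :=
  forall u, \sum_(i < k.+1) q i *m h (i + u)%N = if u == k then 1%:M else 0.

Definition conv_rinv (K : fieldType) (n k : nat) (q h : nat -> 'M[K]_n) :=
  forall u, \sum_(i < k.+1) h (i + u)%N *m q i = if u == k then 1%:M else 0.

(** Associativity in C = (C H) Q, for C(mu) = \sum_(a <= k) mu^a c_a: the inner sum is the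
    coefficient of mu^(m - j) in C H. *)
Lemma coef_of_convolution (K : fieldType) (n p k : nat) (q h : nat -> 'M[K]_n)
    (c : nat -> 'M[K]_(p, n)) (m : nat) :
  conv_rinv k q h -> (m <= k)%N ->
  c m = \sum_(j < k.+1)
          (\sum_(a < k.+1) c a *m h (a + (j + (k - m)))%N) *m q j.
Proof.
move=> hR le_mk.
under eq_bigr do rewrite mulmx_suml.
rewrite exchange_big /=.
under eq_bigr => a _.
  under eq_bigr do rewrite addnCA -mulmxA.
  rewrite -mulmx_sumr hR; over.
have lt_mk : (m < k.+1)%N by [].
rewrite (bigD1 (Ordinal lt_mk)) //= ifT; last by apply/eqP; lia.
rewrite mulmx1 big1 ?addr0 // => a ne_am.
rewrite ifF ?mulmx0 //; apply/eqP => e.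
by case/eqP: ne_am; apply/val_inj => /=; lia.
Qed.

(** Taking C = Q above: Q = (Q H) Q' = Q'. *)
Lemma conv_linv_rinv_unique (K : fieldType) (n k : nat)
    (q q' h : nat -> 'M[K]_n) (m : nat) :
  conv_linv k q h -> conv_rinv k q' h -> (m <= k)%N -> q m = q' m.
Proof.
move=> hL hR le_mk; rewrite (coef_of_convolution q hR le_mk).
have lt_mk : (m < k.+1)%N by [].
rewrite (bigD1 (Ordinal lt_mk)) //= hL ifT; last by apply/eqP; lia.
rewrite mul1mx big1 ?addr0 // => j ne_jm.
rewrite hL ifF ?mul0mx //; apply/eqP => e.
by case/eqP: ne_jm; apply/val_inj => /=; lia.
Qed.

(** As [q k] is invertible, the identity at u = t - k solves for [h t] in terms of earlier
    values. *)
Lemma conv_linv_unique (K : fieldType) (n k : nat)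
    (q h h' : nat -> 'M[K]_n) :
  q k \in unitmx ->
  (forall t, (t < k)%N -> h t = h' t) ->
  conv_linv k q h -> conv_linv k q h' -> h =1 h'.
Proof.
move=> hqk h0 hL hL'; elim/ltn_ind => t IH.
case: (ltnP t k) => [/h0 //|le_kt].
have := hL (t - k)%N; rewrite -hL' !big_ord_recr /=.
rewrite subnKC // (eq_bigr (fun i : 'I_k => q i *m h' (i + (t - k))%N)).
  by move/addrI/(can_inj (mulKmx hqk)).
by move=> i _; rewrite IH //; have := ltn_ord i; lia.
Qed.

(** Since Q (H Q) = (Q H) Q = Q and [q k] is invertible, the coefficients of H Q are forced one at a
    time. *)
Lemma conv_linv_rinv (K : fieldType) (n k : nat) (q h : nat -> 'M[K]_n) :
  (forall t, (t < k + k)%N -> h t = 0) ->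
  conv_linv k q h -> conv_rinv k q h.
Proof.
move=> h0 hL.
have hk1 : q k *m h (k + k)%N = 1%:M.
  have := hL k; rewrite eqxx big_ord_recr /= big1 ?add0r // => i _.
  by rewrite h0 ?mulmx0 //; have := ltn_ord i; lia.
have [hqk _] := mulmx1_unit hk1.
elim/ltn_ind => u IH.
case: (ltngtP u k) => [lt_uk|lt_ku|->].
- by rewrite big1 // => i _; rewrite h0 ?mul0mx //; have := ltn_ord i; lia.
- pose S v := \sum_(i < k.+1) h (i + v)%N *m q i.
  (* Both sides are the coefficient of mu^(2k - u). By induction the terms below k agree, which
     leaves q_k S_u = 0. *)
  have E : \sum_(i < k.+1) q i *m S (i + (u - k))%N
           = \sum_(j < k.+1) (if (j + (u - k))%N == k then 1%:M else 0) *m q j.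
    under eq_bigr do rewrite mulmx_sumr.
    rewrite exchange_big; apply: eq_bigr => j _.
    rewrite -hL mulmx_suml; apply: eq_bigr => i _.
    by rewrite mulmxA addnCA.
  transitivity (S u) => //; move: E; rewrite !(big_ord_recr k) /= subnKC ?(ltnW lt_ku) //.
  rewrite [X in _ = _ + X *m _]ifF ?mul0mx ?addr0; last by apply/eqP; lia.
  rewrite (eq_bigr (fun j : 'I_k =>
             (if (j + (u - k))%N == k then 1%:M else 0) *m q j)).
    rewrite -[X in _ = X -> _]addr0 => /addrI qS0.
    by apply: (can_inj (mulKmx hqk)); rewrite mulmx0.
  move=> i _; rewrite /S IH; last by have := ltn_ord i; lia.
  by case: eqP; rewrite ?mulmx1 ?mul1mx ?mulmx0 ?mul0mx.
- rewrite big_ord_recr /= big1 ?add0r; first exact: mulmx1C.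
  by move=> i _; rewrite h0 ?mul0mx //; have := ltn_ord i; lia.
Qed.

(** * Moments of the triple X, J, Y *)

(** The coefficient of mu^(-r - 1) in X (mu - J)^-1 Y. As [h t] goes with mu^(k - t), it sits at t =
    r + k + 1. *)
Definition moment (K : fieldType) (n N : nat) (X : 'M[K]_(n, N))
    (J : 'M[K]_N) (Y : 'M[K]_(N, n)) (r : nat) : 'M[K]_n :=
  X *m J ^+ r *m Y.

Lemma momentM (K : fieldType) (n N : nat) (X : 'M[K]_(n, N))
    (J T : 'M[K]_N) (Y : 'M[K]_(N, n)) (r : nat) :
  moment X J (T *m Y) r = X *m J ^+ r *m T *m Y.
Proof. by rewrite /moment mulmxA. Qed.

Lemma mulmx_exprD (K : fieldType) (n N : nat) (X : 'M[K]_(n, N)) (J : 'M[K]_N)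
    (a b : nat) : X *m J ^+ (a + b) = X *m J ^+ a *m J ^+ b.
Proof. by rewrite exprD -mulmxE mulmxA. Qed.

(* For k >= 2 the truncated subtraction is harmless, since moment 0 vanishes. *)
Lemma moment_linv (K : fieldType) (n N k : nat) (X : 'M[K]_(n, N))
    (J : 'M[K]_N) (Y : 'M[K]_(N, n)) (q : nat -> 'M[K]_n) :
  (1 < k)%N ->
  \sum_(j < k.+1) q j *m X *m J ^+ j = 0 ->
  (forall r, (r <= k - 2)%N -> moment X J Y r = 0) ->
  q k *m moment X J Y (k - 1) = 1%:M ->
  conv_linv k q (fun t => moment X J Y (t - k.+1)).
Proof.
move=> hk hq h0 h1 u; case: (ltngtP u k) => [lt_uk|lt_ku|->].
- by rewrite big1 // => i _; rewrite h0 ?mulmx0 //; have := ltn_ord i; lia.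
(* For u > k the subtraction is exact and J^(u - k - 1) factors out of the standard pair
   relation. *)
- transitivity ((\sum_(j < k.+1) q j *m X *m J ^+ j) *m J ^+ (u - k.+1) *m Y).
    rewrite !mulmx_suml; apply: eq_bigr => i _.
    by rewrite -addnBA // /moment mulmx_exprD !mulmxA.
  by rewrite hq !mul0mx.
- rewrite big_ord_recr /= (_ : k + k - k.+1 = k - 1)%N; last by lia.
  rewrite h1 big1 ?add0r // => i _.
  by rewrite h0 ?mulmx0 //; have := ltn_ord i; lia.
Qed.

Lemma moment_shift0 (K : fieldType) (n N k : nat) (X : 'M[K]_(n, N))
    (J : 'M[K]_N) (Y : 'M[K]_(N, n)) :
  (1 < k)%N -> (forall r, (r <= k - 2)%N -> moment X J Y r = 0) ->
  forall t, (t < k + k)%N -> moment X J Y (t - k.+1) = 0.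
Proof. by move=> hk h0 t lt_t; apply: h0; lia. Qed.

(** * Linear systems with the matrix X_L *)

Lemma castmx_mull (K : fieldType) (m m' n p : nat) (e : m = m')
    (A : 'M[K]_(m, n)) (B : 'M[K]_(n, p)) :
  castmx (e, erefl) (A *m B) = castmx (e, erefl) A *m B.
Proof. by case: _ / e; rewrite !castmx_id. Qed.

Lemma castmx_mulr (K : fieldType) (m n n' p : nat) (e : n = n')
    (A : 'M[K]_(m, n')) (B : 'M[K]_(n, p)) :
  A *m castmx (e, erefl) B = castmx (erefl, esym e) A *m B.
Proof. by case: _ / e A => A; rewrite !castmx_id. Qed.

Lemma mul_stack (K : fieldType) (n k p : nat) (X : 'M[K]_(n, k * n))
    (J : 'M[K]_(k * n)) (Z : 'M[K]_(k * n, p)) :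
  stack X J *m Z
  = castmx (sum_const_ord k n, erefl) (\mxcol_(i < k) (X *m J ^+ i *m Z)).
Proof.
by rewrite -mxcol_mul castmx_mull.
Qed.

Lemma stack_inj (K : fieldType) (n k p : nat) (X : 'M[K]_(n, k * n))
    (J : 'M[K]_(k * n)) (Z Z' : 'M[K]_(k * n, p)) :
  stack X J \in unitmx ->
  (forall i, (i < k)%N -> X *m J ^+ i *m Z = X *m J ^+ i *m Z') -> Z = Z'.
Proof.
move=> hS hZ; apply: (can_inj (mulKmx hS)); rewrite !mul_stack.
by congr castmx; apply/eq_mxcolP => i; apply: hZ.
Qed.

Lemma stack_solve (K : fieldType) (n k p : nat) (X : 'M[K]_(n, k * n))
    (J : 'M[K]_(k * n)) (W : nat -> 'M[K]_(n, p)) :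
  stack X J \in unitmx ->
  exists Z : 'M[K]_(k * n, p), forall i, (i < k)%N -> X *m J ^+ i *m Z = W i.
Proof.
move=> hS.
exists (invmx (stack X J) *m
        castmx (sum_const_ord k n, erefl) (\mxcol_(i < k) W i)).
move=> i lt_ik; set Z := invmx _ *m _.
have := mul_stack X J Z; rewrite [X in X = _]mulKVmx //.
by move/(can_inj (castmxK _ _))/eq_mxcolP/(_ (Ordinal lt_ik)).
Qed.

Lemma stack_span (K : fieldType) (n k p : nat) (X : 'M[K]_(n, k * n))
    (J : 'M[K]_(k * n)) (V : 'M[K]_(p, k * n)) :
  stack X J \in unitmx ->
  exists c : nat -> 'M[K]_(p, n), V = \sum_(i < k) c i *m X *m J ^+ i.
Proof.
move=> hS; pose B := \mxcol_(i < k) (X *m J ^+ i).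
have [W ->] : exists W, V = W *m B.
  exists (castmx (erefl, esym (sum_const_ord k n)) (V *m invmx (stack X J))).
  by rewrite -castmx_mulr mulmxKV.
exists (fun i => if insub i is Some j then submxrow W j else 0).
rewrite -{1}(submxrowK W) mul_mxrow_mxcol; apply: eq_bigr => i _.
by rewrite valK mulmxA.
Qed.

(** Injectivity is tested on [cokermx A], which [A] annihilates. *)
Lemma unitmx_of_injective (K : fieldType) (N : nat) (A : 'M[K]_N) :
  (forall W : 'M[K]_N, A *m W = 0 -> W = 0) -> A \in unitmx.
Proof.
by move=> hA; rewrite -row_full_unit -cokermx_eq0; apply/eqP/hA/mulmx_coker.
Qed.

(** * The star operation as an involutive antiautomorphism *)

Section Star.

Context (R : realType) (F : base_field) (s : star_op).
Local Notation K := (field_of R F).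

Lemma conj_scalar_is_zmod_morphism : zmod_morphism (@conj_scalar R F).
Proof. by case: F => //= x y; rewrite rmorphB. Qed.

Lemma conj_scalar_is_monoid_morphism : monoid_morphism (@conj_scalar R F).
Proof.
case: F; first by [].
split; [exact: (rmorph1 (@conjc R)) | exact: (rmorphM (@conjc R))].
Qed.

HB.instance Definition _ :=
  GRing.isZmodMorphism.Build K K conj_scalar conj_scalar_is_zmod_morphism.
HB.instance Definition _ :=
  GRing.isMonoidMorphism.Build K K conj_scalar conj_scalar_is_monoid_morphism.

Lemma conj_scalarK : involutive (@conj_scalar R F).
Proof. by case: F => //= x; rewrite conjcK. Qed.

Lemma starM (m n p : nat) (A : 'M[K]_(m, n)) (B : 'M[K]_(n, p)) :
  star s (A *m B) = star s B *m star s A.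
Proof. by case: s; rewrite /star trmx_mul // map_mxM. Qed.

Lemma starK (m n : nat) (A : 'M[K]_(m, n)) : star s (star s A) = A.
Proof.
case: s; rewrite /= ?trmxK //; apply/matrixP => i j.
by rewrite !mxE conj_scalarK.
Qed.

Lemma star0 (m n : nat) : star s (0 : 'M[K]_(m, n)) = 0.
Proof. by case: s; rewrite /= trmx0 // map_mx0. Qed.

Lemma star1 (n : nat) : star s (1%:M : 'M[K]_n) = 1%:M.
Proof. by case: s; rewrite /= trmx1 // map_mx1. Qed.

Lemma starZ (a : K) (m n : nat) (A : 'M[K]_(m, n)) :
  conj_scalar a = a -> star s (a *: A) = a *: star s A.
Proof.
move=> ha; case: s; rewrite /= linearZ //= map_mxZ.
by congr (_ *: _); exact: ha.
Qed.

Lemma star_sum (I : finType) (P : pred I) (m n : nat) (A : I -> 'M[K]_(m, n)) :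
  star s (\sum_(i | P i) A i) = \sum_(i | P i) star s (A i).
Proof.
by case: s; rewrite /= linear_sum //= raddf_sum.
Qed.

End Star.

(** * Signs, and symmetry up to sign of inverse series *)

Definition sign (K : fieldType) (a : K) : Prop := a = 1 \/ a = -1.

Lemma signM (K : fieldType) (a b : K) : sign a -> sign b -> sign (a * b).
Proof.
by case=> -> [] ->; rewrite ?mulrNN ?mulr1 ?mul1r; [left|right|right|left].
Qed.

Lemma signX (K : fieldType) (a : K) (r : nat) : sign a -> sign (a ^+ r).
Proof.
move=> ha; elim: r => [|r IH]; first by left.
by rewrite exprS; apply: signM.
Qed.

Lemma sign_sqr (K : fieldType) (a : K) : sign a -> a * a = 1.
Proof. by case=> ->; rewrite ?mulrNN mulr1. Qed.

Lemma conj_sign (R : realType) (F : base_field) (a : field_of R F) :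
  sign a -> conj_scalar a = a.
Proof. by case=> ->; rewrite ?rmorphN rmorph1. Qed.

Section Graded.

Context (R : realType) (F : base_field) (s : star_op) (c e : field_of R F).
Local Notation K := (field_of R F).
Hypotheses (hc : sign c) (he : sign e).

Let sign_coef r : sign (c * e ^+ r).
Proof. by apply: signM => //; apply: signX. Qed.

Let coef_shift i u : e ^+ u * (c * e ^+ (i + u).+1) = c * e ^+ i.+1.
Proof.
by rewrite -addSn exprD mulrCA [e ^+ u * _]mulrCA sign_sqr ?mulr1 //; apply: signX.
Qed.

Lemma graded_starK (m : nat) (B : 'M[K]_m) (r : nat) :
  B = (c * e ^+ r) *: star s B -> star s B = (c * e ^+ r) *: B.
Proof. by move=> {2}->; rewrite scalerA sign_sqr ?scale1r. Qed.

(** Applying star to Q H = 1 reverses the product. The sign of h_(i + u) splits into e^u and a sign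
    depending on i alone; e^u is 1 at u = k, the only nonzero coefficient. *)
Lemma star_linv (n k : nat) (q h : nat -> 'M[K]_n) :
  e ^+ k = 1 -> (forall t, star s (h t) = (c * e ^+ t.+1) *: h t) ->
  conv_linv k q h ->
  conv_rinv k (fun j => (c * e ^+ j.+1) *: star s (q j)) h.
Proof.
move=> hek hh hL u.
transitivity (e ^+ u *: star s (if u == k then 1%:M else 0 : 'M[K]_n)).
  rewrite -hL star_sum scaler_sumr; apply: eq_bigr => i _.
  by rewrite starM hh -scalemxAl scalerA -scalemxAr coef_shift.
by case: eqP => [->|_]; rewrite ?star0 ?scaler0 // star1 hek scale1r.
Qed.

(** The mirror image: the known symmetry of [q] is moved onto [h]. *)
Lemma star_rinv (n k : nat) (q h : nat -> 'M[K]_n) :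
  e ^+ k = 1 ->
  (forall j, (j <= k)%N -> star s (q j) = (c * e ^+ j.+1) *: q j) ->
  conv_rinv k q h ->
  conv_linv k q (fun t => (c * e ^+ t.+1) *: star s (h t)).
Proof.
move=> hek hq hR u.
transitivity (e ^+ u *: star s (if u == k then 1%:M else 0 : 'M[K]_n)).
  rewrite -hR star_sum scaler_sumr; apply: eq_bigr => i _.
  rewrite starM hq; last by rewrite -ltnS.
  rewrite -scalemxAl -scalemxAr scalerA -addSn exprD.
  by rewrite mulrA [_ * e ^+ u]mulrC.
by case: eqP => [->|_]; rewrite ?star0 ?scaler0 // star1 hek scale1r.
Qed.

Lemma S_set_exp (N : nat) (J T : 'M[K]_N) (r : nat) :
  T *m star s J = e *: (J *m T) ->
  T *m star s (J ^+ r) = e ^+ r *: (J ^+ r *m T).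
Proof.
move=> hT; elim: r => [|r IH].
  by rewrite !expr0 scale1r star1 mulmx1 mul1mx.
rewrite exprSr -mulmxE starM mulmxA hT -scalemxAl -mulmxA IH -scalemxAr scalerA.
by rewrite -exprS !mulmxA mulmxE -exprS -exprSr.
Qed.

(** Star reverses the product to X (star T) (star J^r) (star X); the two hypotheses restore the
    order at the cost of c and e^r. *)
Lemma star_moment (n N : nat) (X : 'M[K]_(n, N)) (J T : 'M[K]_N) (r : nat) :
  star s T = c *: T -> T *m star s J = e *: (J *m T) ->
  star s (moment X J (T *m star s X) r)
  = (c * e ^+ r) *: moment X J (T *m star s X) r.
Proof.
move=> hT hTJ; rewrite /moment !starM starK hT.
rewrite -!scalemxAr -!scalemxAl -scalerA; congr (_ *: _).
by rewrite -!mulmxA [T *m (_ *m _)]mulmxA S_set_exp // -scalemxAl -scalemxAr !mulmxA.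
Qed.

End Graded.

(** * Coefficients of the reversal and the explicit formulas *)

Section Coefficients.

Context (K : fieldType) (n k : nat).

(** Indices in [nat] fit the convolution lemmas; past k, [inord] falls back to 0. *)
Definition rev_coef (A : mxpolynomial K n k) (j : nat) : 'M[K]_n :=
  reversal A (inord j).

Lemma rev_coefE (A : mxpolynomial K n k) (j : 'I_k.+1) :
  rev_coef A j = A (rev_ord j).
Proof. by rewrite /rev_coef inord_val ffunE. Qed.

Lemma rev_coef_max (A : mxpolynomial K n k) : rev_coef A k = A ord0.
Proof.
by rewrite -[k in LHS]/(val (@ord_max k)) rev_coefE; congr (A _); apply/val_inj;
   rewrite /= subnn.
Qed.

Lemma rev_coef0 (A : mxpolynomial K n k) : rev_coef A 0 = A ord_max.
Proof.
by rewrite -[0%N in LHS]/(val (@ord0 k)) rev_coefE; congr (A _); apply/val_inj;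
   rewrite /= subn1.
Qed.

Lemma rev_coef_sum (X : 'M[K]_(n, k * n)) (J : 'M[K]_(k * n))
    (A : mxpolynomial K n k) :
  \sum_(j < k.+1) reversal A j *m X *m J ^+ j
  = \sum_(j < k.+1) rev_coef A j *m X *m J ^+ j.
Proof. by apply: eq_bigr => j _; rewrite rev_coefE ffunE. Qed.

End Coefficients.

(** If J W = 0, the relation applied to W leaves q_0 X W = 0. An invertible q_0 would give X_L W =
    0, hence W = 0. *)
Lemma singular_reversal (K : fieldType) (n k : nat) (X : 'M[K]_(n, k * n))
    (J : 'M[K]_(k * n)) (q : nat -> 'M[K]_n) :
  stack X J \in unitmx -> J \notin unitmx ->
  \sum_(j < k.+1) q j *m X *m J ^+ j = 0 -> q 0%N \notin unitmx.
Proof.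
move=> hS hJ hq; apply: contra hJ => hq0.
apply: unitmx_of_injective => W hW.
have hJW i : J ^+ i.+1 *m W = 0 by rewrite exprSr -mulmxE -mulmxA hW mulmx0.
have hXW : X *m W = 0.
  apply: (can_inj (mulKmx hq0)); rewrite mulmx0.
  move: (congr1 (mulmx^~ W) hq); rewrite mul0mx mulmx_suml big_ord_recl /=.
  rewrite big1 ?addr0 => [|i _]; last by rewrite -mulmxA hJW mulmx0.
  by rewrite expr0 mulmx1 mulmxA.
apply: (stack_inj hS) => -[|i] _; rewrite mulmx0 -mulmxA ?hJW ?mulmx0 //.
by rewrite expr0 mul1mx.
Qed.

(** The formula for A_(k - j) is the coefficient of mu^(j - k) in Q H = 1. *)
Lemma formulas_of_standard (R : realType) (F : base_field) (s : star_op)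
    (n k : nat) (X : 'M[field_of R F]_(n, k * n)) (J T : 'M[field_of R F]_(k * n))
    (A : mxpolynomial (field_of R F) n k) :
  (1 < k)%N ->
  \sum_(j < k.+1) rev_coef A j *m X *m J ^+ j = 0 ->
  X *m J ^+ (k - 1) *m T *m star s X \in unitmx ->
  (forall r, (r <= k - 2)%N -> X *m J ^+ r *m T *m star s X = 0) ->
  A ord0 = invmx (X *m J ^+ (k - 1) *m T *m star s X) ->
  coefficient_formulas s X J T A.
Proof.
move=> hk hq hM h0 hA0; split=> // j lt_jk.
have hL : conv_linv k (rev_coef A)
            (fun t => moment X J (T *m star s X) (t - k.+1)).
  apply: moment_linv => // [r le_r|].
    by rewrite momentM h0.
  by rewrite rev_coef_max hA0 momentM mulVmx.
(* Here u = 2k - j: the terms i < j are zero moments, and i = j carries the moment A_0^-1. *)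
have := hL (k + k - j)%N; rewrite ifF; last by apply/eqP; lia.
rewrite (bigID (fun i : 'I_k.+1 => (j < i)%N)) /=.
rewrite [X in _ + X](bigD1 j) ?ltnn //= [X in _ + (_ + X)]big1 ?addr0; last first.
  move=> i /andP[nlt_ji ne_ij]; rewrite momentM h0 ?mulmx0 //.
  have lt_ij : (i < j)%N by rewrite ltn_neqAle ne_ij leqNgt.
  by have := ltn_ord j; lia.
rewrite rev_coefE (_ : (j + (k + k - j) - k.+1 = k - 1)%N); last by lia.
rewrite addrC => /eqP; rewrite addr_eq0 => /eqP E.
have -> : A (rev_ord j)
    = A (rev_ord j) *m moment X J (T *m star s X) (k - 1) *m A ord0.
  by rewrite hA0 momentM mulmxK.
rewrite E mulNmx mulmx_suml; congr (- _); apply: eq_bigr => i lt_ji.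
rewrite rev_coefE /moment !mulmxA.
by rewrite (_ : (i + (k + k - j) - k.+1 = k - j + i - 1)%N); last lia.
Qed.

(** The formula for A_(k - j) involves only A_0 and A_(k - i) with i > j, hence induction on k -
    j. *)
Lemma formulas_unique (R : realType) (F : base_field) (s : star_op)
    (n k : nat) (X : 'M[field_of R F]_(n, k * n)) (J T : 'M[field_of R F]_(k * n))
    (A A' : mxpolynomial (field_of R F) n k) :
  coefficient_formulas s X J T A -> coefficient_formulas s X J T A' -> A = A'.
Proof.
move=> [hA0 hA] [hA0' hA']; apply/ffunP => j0; rewrite -(rev_ordK j0).
move: (rev_ord j0) => j {j0}.
have [m le_m] := ubnP (k - j); elim: m j le_m => // m IH j le_m.
case: (ltnP j k) => [lt_jk|le_kj].
  rewrite hA // hA' // hA0 hA0'; congr (- _); apply: eq_bigr => i lt_ji.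
  by rewrite IH //; have := ltn_ord i; lia.
have -> : rev_ord j = ord0 by apply/val_inj => /=; lia.
by rewrite hA0 hA0'.
Qed.

(** * The two directions of the equivalence *)

Section StructuredRealization.

Context (R : realType) (F : base_field) (s : star_op) (e1 e2 : field_of R F).
Local Notation K := (field_of R F).
Context (n k : nat).
Hypotheses (he1 : sign e1) (he2 : sign e2) (hk : (2 <= k)%N) (hk_even : ~~ odd k).
Implicit Types (A : mxpolynomial K n k).
Implicit Types (X : 'M[K]_(n, k * n)) (J T : 'M[K]_(k * n)).

Local Notation e := (e1 * e2).

Let he : sign e. Proof. exact: signM. Qed.

Let sign_expr r : e ^+ r = if odd r then e else 1.
Proof.
elim: r => [|r IH] //=; rewrite exprS IH.
by case: (odd r); rewrite /= ?mulr1 ?sign_sqr.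
Qed.

Let hek : e ^+ k = 1. Proof. by rewrite sign_expr (negbTE hk_even). Qed.

(** For k even, k - j has the parity of j, and e2 e = e1. This puts the signs in the form of
    [star_linv], with c = e2. *)
Lemma structuredP A :
  structured s e1 e2 A <->
  forall j, (j <= k)%N ->
    star s (rev_coef A j) = (e2 * e ^+ j.+1) *: rev_coef A j.
Proof.
have E (j : 'I_k.+1) :
    e2 * e ^+ j.+1 = if odd (rev_ord j) then e2 else e1.
  rewrite sign_expr /= subSS oddB; last by rewrite -ltnS.
  rewrite (negbTE hk_even) /=.
  by case: (odd j); rewrite /= ?mulr1 // mulrCA sign_sqr ?mulr1.
split=> hA j; last first.
  by rewrite -(rev_ordK j) -rev_coefE hA -1?ltnS // E.
rewrite -ltnS => lt_jk.
by have := hA (rev_ord (Ordinal lt_jk)); rewrite -rev_coefE -E.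
Qed.

Lemma structured_of_admissible X J T A :
  \sum_(j < k.+1) rev_coef A j *m X *m J ^+ j = 0 ->
  admissible s e1 e2 X J T ->
  A ord0 = invmx (X *m J ^+ (k - 1) *m T *m star s X) ->
  structured s e1 e2 A.
Proof.
move=> hq [_ [hTs hTJ] hM h0] hA0; apply/structuredP => j le_jk.
have h0' r : (r <= k - 2)%N -> moment X J (T *m star s X) r = 0.
  by move=> le_r; rewrite momentM h0.
have hL : conv_linv k (rev_coef A)
            (fun t => moment X J (T *m star s X) (t - k.+1)).
  by apply: moment_linv => //; rewrite rev_coef_max hA0 momentM mulVmx.
apply: graded_starK => //.
(* The right inverse produced by [star_linv], to be identified with the left one. *)
pose q' j := (e2 * e ^+ j.+1) *: star s (rev_coef A j).
rewrite -/(q' j).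
apply: (conv_linv_rinv_unique (q' := q') hL _ le_jk); apply: star_linv hL => // t.
case: (leqP t k) => [le_tk|lt_kt]; first by rewrite h0' ?star0 ?scaler0 //; lia.
(* The exponents t + 1 and t - k - 1 differ by k + 2, which is even. *)
rewrite (star_moment _ _ hTs hTJ); congr (_ * _ *: _).
rewrite -[in RHS](subnK lt_kt) -addnS exprD [e ^+ k.+2]exprS exprS hek.
by rewrite mulr1 sign_sqr ?mulr1.
Qed.

Lemma realization_of_admissible X J T :
  stack X J \in unitmx -> J \notin unitmx -> admissible s e1 e2 X J T ->
  exists A, structured_realization s e1 e2 X J A /\ coefficient_formulas s X J T A.
Proof.
move=> hS hJ hT; have [_ _ hM h0] := hT.
(* Expanding X J^k in the blocks of X_L gives a monic relation; [A0] times it is Q. *)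
have [c hc] := stack_span (X *m J ^+ k) hS.
pose A0 := invmx (X *m J ^+ (k - 1) *m T *m star s X).
pose q (j : nat) : 'M[K]_n := if (j < k)%N then - (A0 *m c j) else A0.
pose A : mxpolynomial K n k := [ffun j : 'I_k.+1 => q (k - j)%N].
have qE j : (j <= k)%N -> rev_coef A j = q j.
  rewrite -ltnS => lt_jk; rewrite (rev_coefE A (Ordinal lt_jk)) ffunE /=.
  by congr q; lia.
have AE : A ord0 = A0 by rewrite ffunE /q subn0 ltnn.
have hq : \sum_(j < k.+1) rev_coef A j *m X *m J ^+ j = 0.
  rewrite big_ord_recr /= qE // /q ltnn -[A0 *m X *m _]mulmxA hc mulmx_sumr.
  rewrite -big_split big1 // => i _ /=; rewrite qE /q ?ltn_ord 1?ltnW //.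
  by rewrite !mulNmx !mulmxA addNr.
exists A; split; last exact: formulas_of_standard.
split.
- exact: structured_of_admissible hq hT AE.
- by rewrite AE unitmx_inv.
- by rewrite -rev_coef0; apply: singular_reversal hq.
- by split=> //; rewrite rev_coef_sum.
Qed.

Lemma admissible_of_realization X J A :
  structured_realization s e1 e2 X J A ->
  exists T, admissible s e1 e2 X J T /\ coefficient_formulas s X J T A.
Proof.
move=> [/structuredP hA hA0 _ [hS]]; rewrite rev_coef_sum => hq.
(* The first k moments are prescribed as 0, ..., 0, A_0^-1. *)
have [Y hY] := stack_solve (fun i => if i == (k - 1)%N then invmx (A ord0) else 0) hS.
have h0 r : (r <= k - 2)%N -> moment X J Y r = 0.
  by move=> le_r; rewrite /moment hY ?ifF //; first apply/eqP; lia.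
have h1 : moment X J Y (k - 1) = invmx (A ord0).
  by rewrite /moment hY ?eqxx //; lia.
have hL : conv_linv k (rev_coef A) (fun t => moment X J Y (t - k.+1)).
  by apply: moment_linv => //; rewrite h1 rev_coef_max mulmxV.
have hR := conv_linv_rinv (moment_shift0 hk h0) hL.
(* Star of H Q = 1 yields a second series H' with Q H' = 1; uniqueness identifies it with H. *)
have hM r : star s (moment X J Y r) = (e2 * e ^+ r) *: moment X J Y r.
  have hL' := star_rinv hek hA hR.
  have := conv_linv_unique _ _ hL hL' (r + k.+1)%N.
  rewrite rev_coef_max addnK => /(_ hA0) E.
  apply: graded_starK => //; rewrite {1}E; last first.
    by move=> t lt_tk; rewrite !h0 ?star0 ?scaler0 //; lia.
  by rewrite -addnS exprD [e ^+ k.+2]exprS exprS hek mulr1 sign_sqr ?mulr1.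
(* The dual relation: its block i is the coefficient of mu^(-i - 1) in H Q = 1. *)
have hYq : \sum_(j < k.+1) J ^+ j *m Y *m rev_coef A j = 0.
  apply: (stack_inj hS) => i lt_ik; rewrite mulmx0 mulmx_sumr.
  have := hR (i + k.+1)%N; rewrite ifF; last by apply/eqP; lia.
  move=> hRi; rewrite -[RHS]hRi; apply: eq_bigr => j _.
  by rewrite addnA addnK addnC /moment mulmx_exprD !mulmxA.
(* This choice is forced: [T *m star s X = Y] and the two symmetries of T imply X J^b T = Z_b. *)
pose Z b := (e2 * e ^+ b) *: star s (J ^+ b *m Y).
have [T hT] := stack_solve Z hS.
(* With coefficients q_j, both X J^j T and Z_j sum to zero, and they agree for j < k; q_k is then
   cancelled. *)
have hTk : X *m J ^+ k *m T = Z k.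
  have hA0' : rev_coef A k \in unitmx by rewrite rev_coef_max.
  apply: (can_inj (mulKmx hA0')).
  have : \sum_(j < k.+1) rev_coef A j *m Z j = 0.
    transitivity (e *: star s (\sum_(j < k.+1) J ^+ j *m Y *m rev_coef A j)); last first.
      by rewrite hYq star0 scaler0.
    rewrite star_sum scaler_sumr; apply: eq_bigr => j _.
    rewrite starM hA -1?ltnS // -scalemxAl -scalemxAr scalerA; congr (_ *: _).
    by rewrite exprS mulrCA (mulrA e e) sign_sqr // mul1r.
  move=> hZ; have := congr1 (mulmx^~ T) hq.
  rewrite mul0mx mulmx_suml => hqT; have := etrans hZ (esym hqT).
  rewrite !big_ord_recr /= (eq_bigr (fun i : 'I_k => rev_coef A i *m X *m J ^+ i *m T)).
    by move=> /addrI ->; rewrite !mulmxA.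
  by move=> i _; rewrite -hT // !mulmxA.
have hTb b : (b <= k)%N -> X *m J ^+ b *m T = Z b.
  by rewrite leq_eqVlt => /predU1P[->|/hT].
have hTX : T *m star s X = Y.
  apply: (stack_inj hS) => b lt_bk; rewrite mulmxA hT // -scalemxAl -starM.
  by rewrite mulmxA hM scalerA sign_sqr ?scale1r //; apply: signM => //; apply: signX.
(* Block b = k - 1 uses X J^k T = Z_k. *)
have hTJ : T *m star s J = e *: (J *m T).
  apply: (stack_inj hS) => b lt_bk; rewrite mulmxA hT //.
  rewrite -scalemxAr mulmxA -[X *m J ^+ b *m J]mulmxA mulmxE -exprSr hTb //.
  rewrite /Z -scalemxAl -starM scalerA mulmxA mulmxE -exprS; congr (_ *: _).
  by rewrite exprS mulrCA (mulrA e e) sign_sqr // mul1r.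
have hTs : star s T = e2 *: T.
  apply: (stack_inj hS) => b lt_bk.
  rewrite -scalemxAr hT // /Z scalerA mulrA sign_sqr // mul1r.
  transitivity (star s (T *m star s (J ^+ b) *m star s X)).
    by rewrite !starM !starK mulmxA.
  rewrite (S_set_exp _ hTJ) -scalemxAl starZ; last first.
    by apply: conj_sign; apply: signX.
  by rewrite -mulmxA hTX.
have hTu : T \in unitmx.
  apply: unitmx_of_injective => W hW.
  (* For z = star W, T W = 0 gives z J^r Y = 0 for all r. With z = \sum_(i < k) c_i X J^i this means
     C H = 0, so C = (C H) Q = 0. *)
  have [c hc] := stack_span (star s W) hS.
  (* The sum in [coef_of_convolution] includes the index k, the expansion of z does not. *)
  pose c' i := if (i < k)%N then c i else 0.
  have hcY r : \sum_(a < k.+1) c' a *m moment X J Y (a + r - k.+1) = 0.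
    case: (leqP r k) => [le_rk|lt_kr].
      rewrite big1 // => a _; rewrite /c'; case: ifP => [lt_ak|_]; last by rewrite mul0mx.
      by rewrite h0 ?mulmx0 //; lia.
    rewrite big_ord_recr /= {2}/c' ltnn mul0mx addr0.
    transitivity (star s W *m J ^+ (r - k.+1) *m Y).
      rewrite hc !mulmx_suml; apply: eq_bigr => a _.
      by rewrite /c' ltn_ord -addnBA // /moment mulmx_exprD !mulmxA.
    transitivity (star s (star s Y *m star s (J ^+ (r - k.+1)) *m W)).
      by rewrite !starM !starK mulmxA.
    rewrite -hTX [star s (T *m _)]starM starK hTs -scalemxAr -scalemxAl -[X *m T *m _]mulmxA.
    rewrite (S_set_exp _ hTJ) -scalemxAr -!scalemxAl -!mulmxA hW.
    by rewrite !mulmx0 !scaler0 star0.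
  have c0 a : (a < k)%N -> c a = 0.
    move=> lt_ak; have := coef_of_convolution c' hR (ltnW lt_ak).
    rewrite {1}/c' lt_ak => ->; rewrite big1 // => j _.
    by rewrite hcY mul0mx.
  rewrite -[W](starK s) hc big1 ?star0 // => i _.
  by rewrite c0 // !mul0mx.
have hMT r : X *m J ^+ r *m T *m star s X = moment X J Y r by rewrite -mulmxA hTX.
have hMu : X *m J ^+ (k - 1) *m T *m star s X \in unitmx.
  by rewrite hMT h1 unitmx_inv.
exists T; split; last first.
  apply: formulas_of_standard => // [r le_r|]; first by rewrite hMT h0.
  by rewrite hMT h1 invmxK.
by split=> // r le_r; rewrite hMT h0.
Qed.

End StructuredRealization.

(** * Singularity of J and the final equivalence *)

Lemma join_diag_singular (K : fieldType) (l N : nat) (hl : (l <= N)%N)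
    (J1 : 'M[K]_l) (Joo : 'M[K]_(N - l)) :
  eigenvalue Joo 0 -> join_diag hl J1 Joo \notin unitmx.
Proof.
move=> h0; rewrite /join_diag.
have -> : forall m (e : (l + (N - l))%N = m) (B : 'M[K]_(l + (N - l))),
    (castmx (e, e) B \in unitmx) = (B \in unitmx).
  by move=> m e B; case: _ / e; rewrite castmx_id.
rewrite unitmxE det_ublock unitrM -!unitmxE negb_and; apply/orP; right.
case/eigenvalueP: h0 => v; rewrite scale0r => hv; apply: contra => hJ.
by rewrite -(mulmxK hJ v) hv mul0mx.
Qed.

Theorem theorem2p9 (R : realType) (F : base_field) (s : star_op)
    (e1 e2 : field_of R F) (n k l : nat)
    (he1 : e1 = 1 \/ e1 = -1) (he2 : e2 = 1 \/ e2 = -1)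
    (hn : (1 <= n)%N) (hk : (2 <= k)%N) (hk_even : ~~ odd k)
    (hl : (l < k * n)%N)
    (XF : 'M[field_of R F]_(n, l)) (Xoo : 'M[field_of R F]_(n, k * n - l))
    (JF : 'M[field_of R F]_l) (Joo : 'M[field_of R F]_(k * n - l))
    (hJF : JF \in unitmx)
    (hJoo : jordan_matrix Joo)
    (hJoo0 : forall a : field_of R F, eigenvalue Joo a <-> a = 0) :
  let X : 'M[field_of R F]_(n, k * n) := join_row (ltnW hl) XF Xoo in
  let J : 'M[field_of R F]_(k * n) := join_diag (ltnW hl) (invmx JF) Joo in
  [/\ (exists A : mxpolynomial (field_of R F) n k,
         structured_realization s e1 e2 X J A)
      <->
      (stack X J \in unitmx /\
       exists T : 'M[field_of R F]_(k * n), admissible s e1 e2 X J T),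
      forall A : mxpolynomial (field_of R F) n k,
        structured_realization s e1 e2 X J A ->
        exists T : 'M[field_of R F]_(k * n),
          admissible s e1 e2 X J T /\ coefficient_formulas s X J T A &
      stack X J \in unitmx ->
      forall T : 'M[field_of R F]_(k * n), admissible s e1 e2 X J T ->
        (exists! A : mxpolynomial (field_of R F) n k,
           coefficient_formulas s X J T A) /\
        (forall A : mxpolynomial (field_of R F) n k,
           coefficient_formulas s X J T A ->
           structured_realization s e1 e2 X J A)].
Proof.
move=> X J.
(* The eigenvalue 0 of [Joo] makes J singular, whence A_k will be singular. *)
have hJ : J \notin unitmx by apply: join_diag_singular; apply/hJoo0.
split.
- split=> [[A hA]|[hS [T hT]]].
    have [T [hT _]] := admissible_of_realization he1 he2 hk hk_even hA.
    by have [_ _ _ [hS _]] := hA; split=> //; exists T.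
  by have [A [hA _]] := realization_of_admissible he1 he2 hk hk_even hS hJ hT; exists A.
- by move=> A; apply: admissible_of_realization.
- move=> hS T hT.
  have [A [hA hf]] := realization_of_admissible he1 he2 hk hk_even hS hJ hT.
  split=> [|A' hf']; last by rewrite -(formulas_unique hf hf').
  by exists A; split=> // A' hf'; apply: formulas_unique hf hf'.
Qed.
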